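(* The chromatic symmetric function $X_{C_{n,v}}$ of the cycle $C_n$ twinned at a vertex $v$ is $e$-positive. For $n\ge 5$, it satisfies the $e$-positive recurrence $$X_{C_{n,v}}=\sum_{k=3}^{n-2}(k-1)e_kX_{C_{n-k,v}}+2(n+1)(2n-3)e_{n+1}+2(n-1)(n-3)e_ne_1+e_2\bigl[X_{C_{n-2,v}}-2(n-3)e_{n-1}\bigr],$$ (in particular the bracketed term is $e$-positive), with initial conditions $X_{C_{1,v}}=2e_2$, $X_{C_{2,v}}=6e_3$, $X_{C_{3,v}}=24e_4$, and $X_{C_{4,v}}=50e_5+6e_4e_1+4e_3e_2$.
   Context: The chromatic symmetric function of a finite simple graph $H=(V,E)$ is $X_H=\sum_\kappa\prod_{u\in V}x_{\kappa(u)}$, the sum over all proper colorings $\kappa:V\to\mathbb{Z}_{>0}$. $C_n$ ($n\ge 3$) is the cycle on $n$ vertices; for the twinned graphs with small $n$, $C_1$ is taken to be a single vertex and $C_2$ a single edge, so $C_{1,v}=K_2$ and $C_{2,v}=K_3$. The twin of a graph at a vertex $v$ is obtained by adding a new vertex $v'$ joined to $v$ and to all neighbors of $v$; $C_{n,v}$ denotes $C_n$ twinned at a vertex $v$. $e_i$ is the $i$-th elementary symmetric function; a symmetric function is $e$-positive if its expansion in the basis of elementary symmetric functions has nonnegative coefficients. *)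

(* Defs.v *)
From HB Require Import structures.
From mathcomp Require Import all_boot all_order all_algebra.
From mathcomp Require Import finmap monalg.
From mathcomp Require Import boolp classical_sets functions cardinality fsbigop.
Set Implicit Arguments.
Unset Strict Implicit.
Unset Printing Implicit Defensive.
Import Order.TTheory GRing.Theory Num.Theory.
Local Open Scope ring_scope.

(* Formal power series over int in countably many variables x_0, x_1, ...:
   a series is the family of its coefficients, indexed by the monomials
   {cmonom nat}.  Symmetric functions live in this ring. *)
Record fps := FPS { coef_fps :> {cmonom nat} -> int }.

HB.instance Definition _ := [isNew for coef_fps].
HB.instance Definition _ := [Choice of fps by <:].

Lemma fpsP (f g : fps) : (forall m, f m = g m) <-> f = g.
Proof. by split=> [fg|->//]; apply/val_inj/funext. Qed.

Section Ring.
Implicit Types (f g h : fps) (m d : {cmonom nat}).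

Definition fps_zero := FPS (fun=> 0).
Definition fps_opp f := FPS (fun m => - f m).
Definition fps_add f g := FPS (fun m => f m + g m).
Definition fps_one := FPS (fun m => (m == mone)%:R).
Definition fps_mul f g := FPS (fun m =>
  \sum_(p \in [set p : {cmonom nat} * {cmonom nat} |
                 mmul p.1 p.2 = m]%classic) f p.1 * g p.2).

Lemma fps_addA : associative fps_add.
Proof. by move=> f g h; apply/fpsP => m; apply: addrA. Qed.
Lemma fps_addC : commutative fps_add.
Proof. by move=> f g; apply/fpsP => m; apply: addrC. Qed.
Lemma fps_add0 : left_id fps_zero fps_add.
Proof. by move=> f; apply/fpsP => m; apply: add0r. Qed.
Lemma fps_addN : left_inverse fps_zero fps_opp fps_add.
Proof. by move=> f; apply/fpsP => m; apply: addNr. Qed.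

HB.instance Definition _ :=
  GRing.isZmodule.Build fps fps_addA fps_addC fps_add0 fps_addN.

Lemma finite_mdivisors m :
  finite_set [set d : {cmonom nat} | exists d', mmul d d' = m]%classic.
Proof.
pose T := {ffun finsupp m -> 'I_(mdeg m).+1}.
pose F (c : T) : {cmonom nat} := [cmonom (c i : nat) | i : finsupp m]%M.
apply: (@sub_finite_set _ _ (range F)); last exact/finite_image/finite_finset.
move=> d [d' dm]; pose c : T := [ffun i => inord (d (val i))].
have led i : (d i <= m i)%N by rewrite -dm cmM leq_addr.
exists c => //; apply/eqP/cmP => i; rewrite /F cmE fsfun_ffun.
case: insubP => [j jm <-|]; rewrite /= ?ffunE.
  rewrite inordK // ltnS (leq_trans (led _)) // mdegE.
  by rewrite (big_fsetD1 (val j)) ?(valP j) //= leq_addr.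
rewrite -cmE_neq0 negbK => /eqP mi0.
by apply/esym/eqP; move: (led i); rewrite mi0 leqn0.
Qed.

Lemma finite_factorizations m :
  finite_set [set p : {cmonom nat} * {cmonom nat} | mmul p.1 p.2 = m]%classic.
Proof.
apply: sub_finite_set (finite_setX (finite_mdivisors m) (finite_mdivisors m)).
by move=> [a b] /= ab; split; [exists b | exists a; rewrite mulmC].
Qed.

Definition mdivisors m : {fset {cmonom nat}} :=
  fset_set [set d : {cmonom nat} | exists d', mmul d d' = m]%classic.

Lemma mdivisorsP m d :
  reflect (exists d', mmul d d' = m) (d \in mdivisors m).
Proof.
by rewrite in_fset_set; [apply/asboolP|exact: finite_mdivisors].
Qed.

Lemma coef_fpsMw (D : {fset {cmonom nat}}) f g m :
  (mdivisors m `<=` D)%fset ->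
  fps_mul f g m =
  \sum_(a <- D) \sum_(b <- D) (f a * g b) *+ (mmul a b == m).
Proof.
move=> /fsubsetP sD; rewrite /fps_mul /=.
pose r := [seq p <- [seq (a, b) | a <- D, b <- D] | mmul p.1 p.2 == m].
rewrite (fsbigE r); first last.
- move=> [a b] /= ab; rewrite mem_filter /= ab eqxx /= => /negP[].
  apply/allpairsP; exists (a, b); split=> //=; apply/sD/mdivisorsP.
    by exists b.
  by exists a; rewrite mulmC.
- by move=> [a b] /=; rewrite mem_filter => /andP[/eqP].
- apply/filter_uniq/allpairs_uniq => //; first by move=> [? ?] [? ?] _ _ [-> ->].
rewrite big_filter_cond big_mkcond /= big_allpairs_dep /=.
apply: eq_bigr => a _; apply: eq_bigr => b _.
case: eqP => [ab|//]; rewrite ifT // inE /=; exact: ab.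
Qed.

Lemma mdivisors_trans m d : d \in mdivisors m ->
  (mdivisors d `<=` mdivisors m)%fset.
Proof.
move=> /mdivisorsP[d' <-]; apply/fsubsetP => a /mdivisorsP[b <-].
by apply/mdivisorsP; exists (mmul b d'); rewrite mulmA.
Qed.

Lemma fps_mulC : commutative fps_mul.
Proof.
move=> f g; apply/fpsP => m; rewrite !(coef_fpsMw _ _ (fsubset_refl _)).
rewrite exchange_big /=; apply: eq_bigr => a _; apply: eq_bigr => b _.
by rewrite mulrC mulmC.
Qed.

Lemma coef_fpsM3 f g h m : fps_mul f (fps_mul g h) m =
  \sum_(a <- mdivisors m) \sum_(b <- mdivisors m) \sum_(c <- mdivisors m)
    (f a * g b * h c) *+ (mmul a (mmul b c) == m).
Proof.
rewrite (coef_fpsMw _ _ (fsubset_refl _)) !big_seq.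
apply: eq_bigr => a /mdivisorsP[e ae].
transitivity (\sum_(x <- mdivisors m) \sum_(b <- mdivisors m)
   \sum_(c <- mdivisors m)
     (f a * g b * h c) *+ (mmul b c == x) *+ (mmul a x == m)).
  rewrite !big_seq; apply: eq_bigr => x xm.
  rewrite (coef_fpsMw _ _ (mdivisors_trans xm)) mulr_sumr -sumrMnl.
  apply: eq_bigr => b _; rewrite mulr_sumr -sumrMnl.
  by apply: eq_bigr => c _; rewrite mulrnAr mulrA.
rewrite exchange_big /=; apply: eq_bigr => b _.
rewrite exchange_big /=; apply: eq_bigr => c _.
have [abc|abc] := eqVneq (mmul a (mmul b c)) m.
  rewrite (big_fsetD1 (mmul b c)) /=; last first.
    by apply/mdivisorsP; exists a; rewrite mulmC.
  rewrite eqxx abc eqxx big_seq big1 ?addr0 // => x.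
  by rewrite in_fsetD1 => /andP[/negbTE nx _]; rewrite eq_sym nx mul0rn.
rewrite big1 // => x _; have [<-|] := eqVneq (mmul b c) x.
  by rewrite (negbTE abc).
by rewrite mul0rn.
Qed.

Lemma fps_mulA : associative fps_mul.
Proof.
move=> f g h; apply/fpsP => m; rewrite [in RHS]fps_mulC !coef_fpsM3.
under eq_bigr do rewrite exchange_big.
rewrite [in RHS]exchange_big /=; apply: eq_bigr => a _.
rewrite [in RHS]exchange_big /= exchange_big /=; apply: eq_bigr => b _.
apply: eq_bigr => c _; congr (_ *+ _); first by rewrite mulrC mulrA.
by rewrite mulmA mulmC.
Qed.

Lemma fps_mul1 : left_id fps_one fps_mul.
Proof.
move=> f; apply/fpsP => m; rewrite (coef_fpsMw _ _ (fsubset_refl _)).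
rewrite (big_fsetD1 mone) /=; last by apply/mdivisorsP; exists m; rewrite mul1m.
rewrite [X in _ + X]big_seq [X in _ + X]big1 => [|a]; last first.
  rewrite in_fsetD1 => /andP[/negbTE a1 _].
  by rewrite big1 // => b _; rewrite a1 mul0r mul0rn.
rewrite addr0 (big_fsetD1 m) /=; last first.
  by apply/mdivisorsP; exists mone; rewrite mulm1.
rewrite big_seq big1 => [|a]; last first.
  by rewrite in_fsetD1 mul1m => /andP[/negbTE -> _].
by rewrite mul1m !eqxx mul1r addr0.
Qed.

Lemma fps_mulDl : left_distributive fps_mul fps_add.
Proof.
move=> f g h; apply/fpsP => m.
transitivity (fps_mul f h m + fps_mul g h m); last by [].
rewrite !(coef_fpsMw _ _ (fsubset_refl _)) -big_split /=.
apply: eq_bigr => a _; rewrite -big_split /=; apply: eq_bigr => b _.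
by rewrite mulrDl mulrnDl.
Qed.

Lemma fps_one_neq0 : fps_one != fps_zero.
Proof. by apply/eqP => /fpsP/(_ mone); rewrite /= eqxx. Qed.

HB.instance Definition _ := GRing.Zmodule_isComNzRing.Build fps
  fps_mulA fps_mulC fps_mul1 fps_mulDl fps_one_neq0.

End Ring.

(* The formal sum of the monomials mon t, for t in A.  The coefficient of m
   counts the t in A with mon t = m; a coefficient for which there are
   infinitely many such t would be read as 0, which finite_coloring_fiber and
   finite_subset_fiber exclude in the two uses below. *)
Definition monomial_sum (T : choiceType) (A : set T) (mon : T -> {cmonom nat}) :
    fps :=
  FPS (fun m => \sum_(t \in A) ((mon t == m)%:R : int)).

Definition subset_monomial (S : {fset nat}) : {cmonom nat} :=
  \big[mmul/mone]_(i <- S) ucm i.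

(* e_k is the sum of x_S over the k-element sets S of variables. *)
Definition elem_sym (k : nat) : fps :=
  monomial_sum [set S : {fset nat} | #|` S| = k]%classic subset_monomial.

Lemma finite_subset_fiber m :
  finite_set [set S | subset_monomial S = m]%classic.
Proof.
apply: (@sub_finite_set _ _ [set` fpowerset (finsupp m)]); last first.
  exact: finite_fset.
move=> S /= <-; rewrite fpowersetE; apply/fsubsetP => i iS.
rewrite -cmE_neq0 /subset_monomial (big_fsetD1 i) //= cmM cmUU.
by rewrite add1n.
Qed.

Record sgraph := SGraph {
  vertex :> finType;
  adj : rel vertex;
  adj_sym : symmetric adj;
  adj_irr : irreflexive adj }.

Section Chromatic.
Variable G : sgraph.

Definition proper_coloring (kappa : {ffun G -> nat}) : Prop :=
  forall u w : G, adj u w -> kappa u <> kappa w.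

Definition coloring_monomial (kappa : {ffun G -> nat}) : {cmonom nat} :=
  \big[mmul/mone]_(u : G) ucm (kappa u).

Lemma finite_coloring_fiber m :
  finite_set [set kappa | coloring_monomial kappa = m]%classic.
Proof.
pose F (c : {ffun G -> finsupp m}) : {ffun G -> nat} := [ffun u => val (c u)].
apply: (@sub_finite_set _ _ (range F)); last exact/finite_image/finite_finset.
move=> kappa /= km.
have kin u : kappa u \in finsupp m.
  rewrite -cmE_neq0 -km /coloring_monomial (bigD1 u) //= cmM cmUU.
  by rewrite add1n.
by exists [ffun u => [` kin u]%fset] => //; apply/ffunP => u; rewrite !ffunE.
Qed.

(* The colours are the elements of nat, colour i standing for the variable
   x_i. *)
Definition chromatic_sym : fps :=
  monomial_sum [set kappa | proper_coloring kappa]%classic coloring_monomial.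

Section Twin.
Variable v : G.

(* None is the new vertex v'. *)
Definition twin_adj (a b : option G) : bool :=
  match a, b with
  | Some u, Some w => adj u w
  | Some u, None | None, Some u => (u == v) || adj v u
  | None, None => false
  end.

Lemma twin_adj_sym : symmetric twin_adj.
Proof. by move=> [u|] [w|] //=; apply: adj_sym. Qed.

Lemma twin_adj_irr : irreflexive twin_adj.
Proof. by move=> [u|] //=; apply: adj_irr. Qed.

Definition twin : sgraph := SGraph twin_adj_sym twin_adj_irr.

End Twin.
End Chromatic.

(* For n >= 3 this is the n-cycle, for n = 2 a single edge and for n = 1 a
   single vertex.  The vertex type is convertible to 'I_n when n is a
   successor; n = 0 is a junk value. *)
Definition cycle_adj (n : nat) : rel 'I_n.-1.+1 :=
  fun i j => (i != j) && ((j == i.+1 %% n :> nat) || (i == j.+1 %% n :> nat))%N.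

Lemma cycle_adj_sym n : symmetric (@cycle_adj n).
Proof. by move=> i j; rewrite /cycle_adj eq_sym orbC. Qed.

Lemma cycle_adj_irr n : irreflexive (@cycle_adj n).
Proof. by move=> i; rewrite /cycle_adj eqxx. Qed.

Definition cycle_graph n : sgraph :=
  SGraph (@cycle_adj_sym n) (@cycle_adj_irr n).

Definition is_partition (la : seq nat) : bool :=
  sorted geq la && all (leq 1) la.

Definition elem_sym_part (la : seq nat) : fps := \prod_(i <- la) elem_sym i.

(* c is the family of coefficients of the expansion of f in the basis of the
   e_la, la a partition; it is unique since the e_la are linearly
   independent. *)
Definition e_positive (f : fps) : Prop :=
  exists c : {fsfun seq nat -> int with 0},
    [/\ {in finsupp c, forall la, is_partition la},
        forall la, 0 <= c la
      & f = \sum_(la <- finsupp c) (c la)%:~R * elem_sym_part la].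

(* Main.v *)
Require Import Defs.
From HB Require Import structures.
From mathcomp Require Import all_boot all_order all_algebra.
From mathcomp Require Import finmap monalg.
From mathcomp Require Import boolp classical_sets functions cardinality fsbigop.
From mathcomp Require Import ring zify.
Set Implicit Arguments.
Unset Strict Implicit.
Unset Printing Implicit Defensive.
Import Order.TTheory GRing.Theory Num.Theory.
Local Open Scope ring_scope.

(* It suffices to work with finitely many colours.  Put y_a = x_a z,
   t_a = y_a / (1 + y_a), T = sum_a t_a, T2 = sum_a t_a^2 and
   E = prod_a (1 + y_a) = sum_k e_k z^k.  With the Euler derivation
   D = z d/dz one has D E = T E and D (D E) - D E = (T^2 - T2) E.

   A proper colouring of the twinned cycle is a pair a <> b of colours for v and
   v', together with a proper colouring of a path whose two ends avoid a and b.
   The generating function W_ab of the latter satisfies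
   (1 - T) W_ab = (1 - T) s + s^2 with s = T - t_a - t_b, by following the path
   one vertex at a time.  Summing y_a y_b W_ab over a <> b, with
   y_a t_a = y_a - t_a, makes (1 - T) W a polynomial in T, T2, e_1 z and
   e_2 z^2.  Multiplying by E turns the identity into one between
   W (E - D E) and explicit series in the e_k, whose coefficients give the
   recurrence.  Positivity follows by induction, the recurrence showing that
   even X_n - 2 (n - 1) e_(n+1) is e-positive for n >= 3. *)

(** * Power series in one variable *)

Record series (R : comNzRingType) := Series { coef_series :> nat -> R }.

Section SeriesRing.
Variable R : comNzRingType.

HB.instance Definition _ := [isNew for @coef_series R].
HB.instance Definition _ := [Choice of series R by <:].

Implicit Types f g h : series R.

Lemma seriesP f g : (forall n, f n = g n) <-> f = g.
Proof. by split=> [fg|->//]; apply/val_inj/funext. Qed.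

Definition series_zero : series R := Series (fun=> 0).
Definition series_opp f := Series (fun n => - f n).
Definition series_add f g := Series (fun n => f n + g n).
Definition series_one : series R := Series (fun n => (n == 0%N)%:R).
Definition series_mul f g :=
  Series (fun n => \sum_(i < n.+1) f i * g (n - i)%N).

Lemma series_addA : associative series_add.
Proof. by move=> f g h; apply/seriesP => n; apply: addrA. Qed.
Lemma series_addC : commutative series_add.
Proof. by move=> f g; apply/seriesP => n; apply: addrC. Qed.
Lemma series_add0 : left_id series_zero series_add.
Proof. by move=> f; apply/seriesP => n; apply: add0r. Qed.
Lemma series_addN : left_inverse series_zero series_opp series_add.
Proof. by move=> f; apply/seriesP => n; apply: addNr. Qed.

HB.instance Definition _ := GRing.isZmodule.Build (series R)
  series_addA series_addC series_add0 series_addN.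

Definition poly_of_series (M : nat) f : {poly R} := \poly_(i < M) f i.

(** Below degree [M] a product of series only sees truncations, so commutativity and associativity
    can be inherited from [{poly R}]. *)
Lemma coef_series_mul M f g (p q : {poly R}) n :
  (forall i, (i < M)%N -> f i = p`_i) -> (forall i, (i < M)%N -> g i = q`_i) ->
  (n < M)%N -> series_mul f g n = (p * q)`_n.
Proof.
move=> fp gq nM; rewrite coefM /=; apply: eq_bigr => i _.
by rewrite fp ?gq //; [apply: leq_ltn_trans nM; apply: leq_subr
  | apply: leq_trans (ltn_ord i) _].
Qed.

Lemma coef_poly_of_series M f i : (i < M)%N -> f i = (poly_of_series M f)`_i.
Proof. by move=> iM; rewrite coef_poly iM. Qed.

Lemma series_mulC : commutative series_mul.
Proof.
move=> f g; apply/seriesP => n; have cp := @coef_poly_of_series n.+1.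
rewrite (coef_series_mul (cp f) (cp g)) // (coef_series_mul (cp g) (cp f)) //.
by rewrite mulrC.
Qed.

Lemma series_mulA : associative series_mul.
Proof.
move=> f g h; apply/seriesP => n; have cp := @coef_poly_of_series n.+1.
have cM f1 f2 i (iM : (i < n.+1)%N) := coef_series_mul (cp f1) (cp f2) iM.
rewrite (coef_series_mul (cp f) (cM g h)) // mulrA.
by rewrite (coef_series_mul (cM f g) (cp h)).
Qed.

Lemma series_mul1 : left_id series_one series_mul.
Proof.
move=> f; apply/seriesP => n; rewrite /= big_ord_recl /= mul1r subn0.
by rewrite big1 ?addr0 // => i _; rewrite mul0r.
Qed.

Lemma series_mulDl : left_distributive series_mul series_add.
Proof.
move=> f g h; apply/seriesP => n /=; rewrite -big_split /=.
by apply: eq_bigr => i _; rewrite mulrDl.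
Qed.

Lemma series_one_neq0 : series_one != series_zero.
Proof. by apply/eqP => /seriesP/(_ 0%N)/= /eqP; rewrite oner_eq0. Qed.

HB.instance Definition _ := GRing.Zmodule_isComNzRing.Build (series R)
  series_mulA series_mulC series_mul1 series_mulDl series_one_neq0.

Lemma coefsD f g n : (f + g) n = f n + g n. Proof. by []. Qed.
Lemma coefsN f n : (- f) n = - f n. Proof. by []. Qed.
Lemma coefsM f g n : (f * g) n = \sum_(i < n.+1) f i * g (n - i)%N.
Proof. by []. Qed.

Lemma coefs_sum (I : Type) (r : seq I) (P : pred I) (F : I -> series R) n :
  (\sum_(i <- r | P i) F i) n = \sum_(i <- r | P i) F i n.
Proof. by elim/big_rec2: _ => // i u w _ <-. Qed.

Definition smonom (c : R) (k : nat) : series R :=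
  Series (fun n => if n == k then c else 0).

Lemma coefs_monomM c k f n :
  (smonom c k * f) n = if (k <= n)%N then c * f (n - k)%N else 0.
Proof.
rewrite coefsM; case: leqP => [kn|nk].
  rewrite (bigD1 (inord k : 'I_n.+1)) //= inordK ?ltnS // eqxx.
  rewrite big1 ?addr0 // => i /eqP ik; case: eqP => [e|]; last by rewrite mul0r.
  by case: ik; apply/val_inj; rewrite /= inordK ?ltnS.
rewrite big1 // => i _ /=; case: eqP => [ik|]; last by rewrite mul0r.
by have := ltn_ord i; rewrite ik ltnS leqNgt nk.
Qed.

Lemma smonomM c d k l : smonom c k * smonom d l = smonom (c * d) (k + l).
Proof.
apply/seriesP => n; rewrite coefs_monomM /=; case: leqP => kn.
  by rewrite -(eqn_add2l k) subnKC //; case: eqP; rewrite ?mulr0.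
by case: eqP => // nkl; move: kn; rewrite nkl ltnNge leq_addr.
Qed.

Lemma smonom1 : smonom 1 0 = 1.
Proof. by apply/seriesP => n /=; case: eqP. Qed.

Lemma smonom_prod (I : finType) (F : I -> R) (A : {set I}) :
  \prod_(i in A) smonom (F i) 1 = smonom (\prod_(i in A) F i) #|A|.
Proof.
rewrite -sum1_card; elim/big_rec3: _ => [|i u w s _ ->].
  by rewrite smonom1.
by rewrite smonomM.
Qed.

(** The derivation z d/dz. *)
Definition euler f : series R := Series (fun n => f n *+ n).

Lemma eulerD f g : euler (f + g) = euler f + euler g.
Proof. by apply/seriesP => n /=; rewrite mulrnDl. Qed.

Lemma euler1 : euler 1 = 0.
Proof. by apply/seriesP => -[|n] //=; rewrite mul0rn. Qed.

Lemma euler_sum (I : Type) (r : seq I) (P : pred I) (F : I -> series R) :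
  euler (\sum_(i <- r | P i) F i) = \sum_(i <- r | P i) euler (F i).
Proof.
apply/seriesP => n; rewrite coefs_sum /= coefs_sum -sumrMnl.
exact: eq_bigr.
Qed.

Lemma eulerM f g : euler (f * g) = euler f * g + f * euler g.
Proof.
apply/seriesP => n; rewrite coefsD !coefsM /= -big_split /= -sumrMnl.
apply: eq_bigr => i _; rewrite mulrnAl mulrnAr -mulrnDr subnKC //.
by rewrite -ltnS.
Qed.

Lemma euler_monom c : euler (smonom c 1) = smonom c 1.
Proof. by apply/seriesP => -[|[|n]] //=; rewrite mul0rn. Qed.

End SeriesRing.

(** * Twinned cycles with finitely many colours *)

Section FiniteColors.
Variables (R : comNzRingType) (C : finType) (x : C -> R).

Definition esym (k : nat) : R :=
  \sum_(S : {set C} | #|S| == k) \prod_(i in S) x i.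

Let y (a : C) : series R := smonom (x a) 1.

(* The series y / (1 + y). *)
Let t (a : C) : series R :=
  Series (fun n => if n is 0 then 0 else - (- x a) ^+ n).

Let T := \sum_a t a.
Let T2 := \sum_a t a ^+ 2.
Let E := \prod_a (1 + y a).
Let p1 := \sum_a y a.
Let p2 := \sum_a y a ^+ 2.

(** This is (1 + y) t = y, arranged as a rewriting rule that makes the product y t linear. *)
Lemma mul_y_t a : y a * t a = y a - t a.
Proof.
apply/seriesP => n; rewrite coefs_monomM coefsD coefsN.
case: n => [|[|n]] /=; first by rewrite oppr0 addr0.
  by rewrite mulr0 expr1 opprK subrr.
by rewrite subn1 /= [in RHS]exprS mulNr !opprK add0r mulrN.
Qed.

Lemma coefs_E n : E n = esym n.
Proof.
(* With [y a] as first summand, the set in [bigA_distr] is the set of those [a] for which [y a] is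
   chosen. *)
rewrite /E; under eq_bigr do rewrite addrC.
rewrite bigA_distr coefs_sum /esym [in RHS]big_mkcond /=.
apply: eq_bigr => S _; rewrite -big_mkcond /= smonom_prod /=.
by rewrite eq_sym.
Qed.

(** Logarithmic derivative of a product: D (1 + y) = y = t (1 + y), so each factor contributes its
    t. *)
Lemma euler_E : euler E = T * E.
Proof.
rewrite /E /T; elim/big_rec2: _ => [|a s f _ IH].
  by rewrite euler1 mul0r.
rewrite eulerM IH eulerD euler1 euler_monom mulrDl -/(y a).
have ta : t a * (1 + y a) = y a.
  by rewrite mulrDr mulr1 mulrC mul_y_t addrC subrK.
transitivity (t a * (1 + y a) * f + (1 + y a) * (s * f)); last by ring.
by rewrite ta; ring.
Qed.

(** Instead of differentiating a quotient, D is applied to y t = y - t and the resulting linear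
    equation is solved for D t. *)
Lemma euler_t a : euler (t a) = t a - t a ^+ 2.
Proof.
have := congr1 (@euler R) (mul_y_t a); rewrite eulerM euler_monom.
have -> : euler (y a - t a) = y a - euler (t a).
  apply/eqP; rewrite eq_sym subr_eq -eulerD subrK.
  by rewrite euler_monom.
move: (mul_y_t a) (euler (t a)); set Y := y a; set s := t a => Ys d dE.
(* The factor equals 1, since 1 - s is the inverse of 1 + Y. *)
suff: (1 + Y) * (1 - s) * d = (1 + Y) * (1 - s) * (s - s ^+ 2).
  have -> : (1 + Y) * (1 - s) = 1.
    by transitivity (1 + (Y - s) - Y * s); [ring | rewrite Ys; ring].
  by rewrite !mul1r.
have d1 : d + Y * d = Y - Y * s.
  transitivity (Y * s + Y * d - Y * s + d); first by ring.
  by rewrite dE; ring.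
transitivity ((1 - s) * (d + Y * d)); first by ring.
rewrite d1; transitivity ((1 - s) ^+ 2 * (Y * s + (Y - Y * s))); first by ring.
rewrite Ys; transitivity ((1 - s) ^+ 2 * (s + (Y - s))); first by ring.
by rewrite -Ys; ring.
Qed.

Lemma euler2_E : euler (euler E) - euler E = (T ^+ 2 - T2) * E.
Proof.
have -> : euler (euler E) = euler T * E + T * (T * E).
  by rewrite {1}euler_E eulerM euler_E.
have -> : euler T = T - T2.
  rewrite /T /T2 euler_sum -sumrB; apply: eq_bigr => a _.
  exact: euler_t.
by rewrite euler_E; ring.
Qed.

Lemma esym0E : esym 0 = 1.
Proof.
rewrite -coefs_E /E; elim/big_rec: _ => // a f _ f0.
by rewrite coefsM big_ord1 f0 coefsD /=; ring.
Qed.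

Lemma coefs_T n : T n.+1 = - \sum_a (- x a) ^+ n.+1.
Proof. by rewrite /T coefs_sum -sumrN. Qed.

Lemma coefs_T0 : T 0 = 0.
Proof. by rewrite /T coefs_sum big1. Qed.

(** Coefficient of z in D E = T E. *)
Lemma esym1E : esym 1 = \sum_a x a.
Proof.
have := congr1 (fun f : series R => f 1%N) euler_E.
rewrite [LHS]/= coefs_E mulr1n => ->; rewrite coefsM !big_ord_recl big_ord0.
rewrite coefs_T0 mul0r add0r addr0 coefs_E esym0E mulr1 coefs_T -sumrN.
by apply: eq_bigr => a _; rewrite expr1 opprK.
Qed.

(** Newton's identity for e_2, the coefficient of z^2 in D E = T E. *)
Lemma esym2E : \sum_a \sum_(b | b != a) x a * x b = esym 2 *+ 2.
Proof.
have := congr1 (fun f : series R => f 2%N) euler_E.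
rewrite [LHS]/= coefs_E => ->; rewrite coefsM !big_ord_recl big_ord0.
rewrite coefs_T0 mul0r add0r addr0 !coefs_E esym0E mulr1 esym1E !coefs_T.
under [X in - X * _]eq_bigr do rewrite expr1.
rewrite sumrN opprK big_distrlr /= -sumrN -big_split /=.
apply: eq_bigr => a _.
by rewrite [in RHS](bigD1 a) //= sqrrN -expr2 addrAC subrr add0r.
Qed.

(* The total weight of the proper colourings of a path on m + 1 vertices whose
   first colour is c and whose last colour satisfies g. *)
Fixpoint walk (g : pred C) (m : nat) (c : C) : R :=
  if m is m'.+1 then x c * \sum_(c' | c' != c) walk g m' c'
  else if g c then x c else 0.

Definition walks (g : pred C) (m : nat) : R := \sum_(c | g c) walk g m c.

(** Here [a] and [b] are the colours of v and v', and the rest of the cycle is a path on [m + 1]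
    vertices whose two ends avoid both. The index [m] thus belongs to the cycle on [m + 2]
    vertices. *)
Definition twin_sum (m : nat) : R :=
  \sum_a \sum_(b | b != a)
    x a * x b * walks [pred c | (c != a) && (c != b)] m.

(** The exponent of z is the number of vertices of the path, hence the shift from [m] to [m.+1]. *)
Let walk_series g c : series R :=
  Series (fun n => if n is m.+1 then walk g m c else 0).

Let walks_series g : series R :=
  Series (fun n => if n is m.+1 then walks g m else 0).

(** Removing the first vertex gives w = y (g + Q - w), because the next colour must differ from [c].
    Solving for w replaces y by y / (1 + y) = t. *)
Lemma walk_seriesE g c :
  walk_series g c = t c * ((g c)%:R + \sum_c' walk_series g c').
Proof.
set Q := \sum_c' _; set w := walk_series g c.
have wE : w = y c * ((g c)%:R + (Q - w)).
  apply/seriesP => -[|m]; rewrite coefs_monomM // ltn0Sn subSS subn0.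
  rewrite !coefsD coefsN /Q coefs_sum.
  case: m => [|m] /=.
    by rewrite big1 // subrr addr0; case: (g c); rewrite ?mulr1 ?mulr0.
  rewrite [in RHS](bigD1 c) //= [_ + _ - _]addrAC subrr add0r.
  by case: (g c); rewrite add0r.
have k : (1 + y c) * (1 - t c) = 1.
  by transitivity (1 + (y c - t c) - y c * t c); [ring | rewrite mul_y_t; ring].
have ty : (1 - t c) * y c = t c.
  by transitivity (y c - y c * t c); [ring | rewrite mul_y_t; ring].
have w1 : (1 + y c) * w = y c * ((g c)%:R + Q).
  by rewrite mulrDl mul1r {1}wE; ring.
transitivity ((1 + y c) * (1 - t c) * w); first by rewrite k mul1r.
by rewrite [_ * (1 - _)]mulrC -mulrA w1 mulrA ty.
Qed.

(** Summing [walk_seriesE] over all colours gives Q = s + T Q, and over those satisfying [g] it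
    gives s + s Q. Multiplying the latter by 1 - T eliminates Q. *)
Lemma walks_seriesE g (s := \sum_(c | g c) t c) :
  (1 - T) * walks_series g = (1 - T) * s + s ^+ 2.
Proof.
set Q := \sum_c walk_series g c.
have -> : walks_series g = s + s * Q.
  transitivity (\sum_(c | g c) walk_series g c).
    apply/seriesP => -[|m]; rewrite coefs_sum //=; first by rewrite big1.
  rewrite /s mulr_suml -big_split /=; apply: eq_bigr => c gc.
  by rewrite walk_seriesE gc -/Q mulrDr mulr1.
have QE : Q = s + T * Q.
  rewrite {1}/Q; under eq_bigr do rewrite walk_seriesE -/Q mulrDr.
  rewrite big_split -mulr_suml /=; congr (_ + _).
  rewrite /s [RHS]big_mkcond; apply: eq_bigr => c _.
  by case: (g c); rewrite ?mulr1 ?mulr0.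
have Q1 : (1 - T) * Q = s by rewrite mulrBl mul1r {1}QE addrK.
by rewrite mulrDr mulrCA Q1 -expr2.
Qed.

(** * The generating function of the twinned cycles *)

Let W : series R := \sum_a \sum_(b | b != a)
  y a * y b * walks_series [pred c | (c != a) && (c != b)].

(** The exponent counts all vertices: two for v and v', and [m + 1] for the path. *)
Lemma coefs_W j : W j = if (2 < j)%N then twin_sum (j - 3) else 0.
Proof.
rewrite /W coefs_sum; under eq_bigr do rewrite coefs_sum.
have cE a b : (y a * y b * walks_series [pred c | (c != a) && (c != b)]) j
   = if (2 < j)%N then
      x a * x b * walks [pred c | (c != a) && (c != b)] (j - 3) else 0.
  rewrite smonomM coefs_monomM; case: j => [|[|[|j]]] //=.
    by rewrite mulr0.
  by rewrite !subSS subn0.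
case: ifP => jn; last first.
  by rewrite big1 // => a _; rewrite big1 // => b _; rewrite cE jn.
by apply: eq_bigr => a _; apply: eq_bigr => b _; rewrite cE jn.
Qed.

Lemma sum_t_avoid a b : b != a ->
  \sum_(c | (c != a) && (c != b)) t c = T - t a - t b.
Proof.
move=> ba; rewrite /T [in RHS](bigD1 a) //= [in RHS](bigD1 b) //=.
rewrite (addrC (t a)) addrK.
by rewrite addrC addrK.
Qed.

Lemma mul_1T_W :
  (1 - T) * W = 4 * (T ^+ 2 - T2) - 6 + 2 * p1 * (T ^+ 2 - T2)
    + (p1 ^+ 2 - p2) + (6 + 6 * p1 + (p1 ^+ 2 - p2)) * (1 - T).
Proof.
(* [h a b] is y_a y_b ((1 - T) s + s^2) for s = T - t_a - t_b, reduced by y t = y - t; [al] and [be]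
   collect the coefficients of y_a y_b and of the mixed products. It makes sense for [a = b] as
   well. *)
pose al : series R := (1 - T) * (T - 2) + T ^+ 2 - 4 * T + 4.
pose be : series R := T - 2.
pose h a b : series R := al * (y a * y b) + be * (t a * y b)
  + be * (y a * t b) + 2 * (t a * t b) - t a ^+ 2 * y b - y a * t b ^+ 2.
have mul_y_t2 a : y a * t a ^+ 2 = y a - t a - t a ^+ 2.
  by rewrite expr2 mulrA mul_y_t mulrBl mul_y_t.
transitivity (\sum_a \sum_(b | b != a) h a b).
  rewrite /W mulr_sumr; apply: eq_bigr => a _.
  rewrite mulr_sumr; apply: eq_bigr => b ba.
  rewrite mulrCA walks_seriesE sum_t_avoid // /h /al /be.
  transitivity (((1 - T) * T + T ^+ 2) * (y a * y b)
    - ((1 - T) + 2 * T) * (y a * t a * y b + y a * (y b * t b))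
    + (y a * t a ^+ 2 * y b + y a * (y b * t b ^+ 2))
    + 2 * (y a * t a) * (y b * t b)); first by ring.
  by rewrite !mul_y_t2 !mul_y_t; ring.
(* The full double sum factors into power sums; the diagonal is corrected separately. *)
transitivity (\sum_a \sum_b h a b - \sum_a h a a).
  rewrite -sumrB; apply: eq_bigr => a _.
  by rewrite [in RHS](bigD1 a) //= addrAC subrr add0r.
have -> : \sum_a h a a = al * p2 + 2 * be * (p1 - T) + 2 * T2
    - 2 * (p1 - T - T2).
  rewrite /p2 /p1 /T2 /T -!sumrB.
  rewrite !mulr_sumr -!big_split -!sumrB /=; apply: eq_bigr => a _.
  rewrite /h.
  transitivity (al * y a ^+ 2 + 2 * be * (y a * t a) + 2 * t a ^+ 2
    - 2 * (y a * t a ^+ 2)); first by ring.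
  by rewrite mul_y_t2 mul_y_t.
have -> : \sum_a \sum_b h a b = al * p1 ^+ 2 + 2 * be * (T * p1)
    + 2 * T ^+ 2 - 2 * (T2 * p1).
  under eq_bigr do rewrite !big_split /= !sumrN -!mulr_sumr.
  have dist (f g : C -> series R) :
      \sum_a f a * \sum_b g b = (\sum_a f a) * \sum_b g b.
    by rewrite mulr_suml.
  rewrite !big_split /= !sumrN -!mulr_sumr !dist.
  rewrite -/p1 -/T -/T2; ring.
by rewrite /al /be; ring.
Qed.

(** Multiplying [mul_1T_W] by E removes T and T2 through [euler_E] and [euler2_E], so that only
    coefficients built from the e_k remain. *)
Lemma mul_W_E : W * (E - euler E) =
  4%:R * (euler (euler E) - euler E) - 6%:R * E
  + smonom (esym 1) 1 * (2%:R * (euler (euler E) - euler E))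
  + smonom (esym 2 *+ 2) 2 * E
  + (6%:R * (E - euler E) + smonom (esym 1) 1 * (6%:R * (E - euler E))
     + smonom (esym 2 *+ 2) 2 * (E - euler E)).
Proof.
have <- : p1 = smonom (esym 1) 1.
  apply/seriesP => n; rewrite /p1 coefs_sum /= esym1E.
  by case: eqP => // _; rewrite big1.
have <- : p1 ^+ 2 - p2 = smonom (esym 2 *+ 2) 2.
  transitivity (\sum_a \sum_(b | b != a) smonom (x a * x b) 2).
    rewrite expr2 big_distrlr /= -sumrB; apply: eq_bigr => a _.
    rewrite (bigD1 a) //= addrAC -expr2 subrr add0r; apply: eq_bigr => b _.
    exact: smonomM.
  apply/seriesP => n; rewrite coefs_sum -esym2E.
  under eq_bigr do rewrite coefs_sum.
  rewrite /=; case: eqP => // _.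
  by rewrite big1 // => a _; rewrite big1.
rewrite euler2_E euler_E.
transitivity ((1 - T) * W * E); first by ring.
by rewrite mul_1T_W; ring.
Qed.

Lemma coefs_natM (k : nat) (f : series R) n : (k%:R * f) n = k%:R * f n.
Proof.
rewrite !mulr_natl; elim: k => [|k IH]; first by rewrite !mulr0n.
by rewrite !mulrS coefsD IH.
Qed.

(** Coefficient of z^(m+3) in [mul_W_E]. The factor [m%:R - 1] is a subtraction in the ring, so the
    formula also holds for [m = 0], where the last two terms cancel. *)
Lemma twin_sum_rec m : twin_sum m =
  \sum_(2 <= k < m.+1) (k - 1)%:R * esym k * twin_sum (m - k)
  + (2 * m.+3 * (2 * m + 1))%:R * esym m.+3
  + 2%:R * m.+1%:R * (m%:R - 1) * esym 1 * esym m.+2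
  - 2%:R * (m%:R - 1) * esym 2 * esym m.+1.
Proof.
(* The coefficient of z^k in E - D E is (1 - k) e_k: [k = 0] yields [twin_sum m] and [k = 1] yields
   nothing. *)
have L : (W * (E - euler E)) m.+3 = twin_sum m
    - \sum_(2 <= k < m.+1) (k - 1)%:R * esym k * twin_sum (m - k).
  rewrite mulrC coefsM -(big_mkord predT
    (fun i => (E - euler E) i * W (m.+3 - i)%N)).
  rewrite big_ltn // big_ltn //.
  have -> : W (m.+3 - 0)%N = twin_sum m by rewrite coefs_W !subSS !subn0.
  rewrite coefsD coefsN [euler _ _]/= mulr0n subr0 coefs_E esym0E mul1r.
  rewrite coefsD coefsN [euler _ _]/= mulr1n subrr mul0r add0r.
  congr (_ + _).
  rewrite [in RHS](big_nat_widen _ _ m.+4) ?ltnS; last first.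
    by rewrite -addn3 leq_addr.
  rewrite -sumrN [RHS]big_mkcond /= !big_nat; apply: eq_bigr => k /andP[k2 _].
  (* As W starts at z^3, the terms with [k > m] vanish. *)
  rewrite ltnS coefs_W; case: (leqP k m) => km; last first.
    have -> : (2 < m.+3 - k)%N = false by lia.
    by rewrite mulr0.
  have -> : (2 < m.+3 - k)%N by lia.
  have -> : (m.+3 - k - 3 = m - k)%N by lia.
  rewrite !coefs_E natrB; last by lia.
  by rewrite -mulr_natr; ring.
have := congr1 (fun f : series R => f m.+3) mul_W_E; rewrite L.
rewrite !(coefsD, coefsN, coefs_monomM, coefs_natM) /= !subSS !subn0 !coefs_E.
move=> /eqP; rewrite subr_eq => /eqP ->.
by ring.
Qed.

End FiniteColors.

(** * Proper colourings of twinned cycles as tuples of colours *)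

Lemma prod_option (R : comNzRingType) (T : finType) (F : option T -> R) :
  \prod_u F u = F None * \prod_i F (Some i).
Proof.
rewrite (bigD1 None) //= (reindex_omap Some id) //=; last by case.
by congr (_ * _); apply: eq_bigl => i; rewrite eqxx.
Qed.

Lemma big_tuple_cons (R : nmodType) (C : finType) n (F : n.+1.-tuple C -> R) :
  \sum_(L : n.+1.-tuple C) F L =
  \sum_a \sum_(s : n.-tuple C) F [tuple of a :: s].
Proof.
rewrite pair_big /=.
rewrite (reindex (fun p : C * n.-tuple C => [tuple of p.1 :: p.2])) //.
exists (fun L : n.+1.-tuple C => (thead L, [tuple of behead L])).
  move=> [a s] _ /=.
  by congr (_, _); apply/val_inj.
by move=> L _ /=; rewrite -tuple_eta.
Qed.

(** Translates between [cycle] and the indices modulo the length by which [cycle_adj] is defined. *)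
Lemma cycle_nthP (C : eqType) (e : rel C) (a : C) (p : seq C) :
  reflect (forall i, (i < (size p).+1)%N ->
             e (nth a (a :: p) i) (nth a (a :: p) (i.+1 %% (size p).+1)))
          (cycle e (a :: p)).
Proof.
have nthE i : (i < (size p).+1)%N ->
    nth a (a :: rcons p a) i = nth a (a :: p) i /\
    nth a (rcons p a) i = nth a (a :: p) (i.+1 %% (size p).+1).
  move=> ip; split.
    by rewrite -rcons_cons nth_rcons /= ip.
  rewrite nth_rcons; move: ip; rewrite ltnS leq_eqVlt => /orP[/eqP->|ip].
    by rewrite ltnn eqxx modnn.
  by rewrite ip modn_small.
apply: (iffP (pathP a)) => H i ip.
  by have := H i; rewrite size_rcons => /(_ ip); have [-> ->] := nthE i ip.
by rewrite size_rcons in ip; have [-> ->] := nthE i ip; apply: H.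
Qed.

Section Colorings.
Variables (R : comNzRingType) (C : finType) (x : C -> R).

Definition properb (G : sgraph) (kappa : {ffun G -> C}) : bool :=
  [forall u, forall w, adj u w ==> (kappa u != kappa w)].

Definition coloring_sum (G : sgraph) : R :=
  \sum_(kappa : {ffun G -> C} | properb kappa) \prod_u x (kappa u).

Lemma walkE (g : pred C) m c :
  walk x g m c = \sum_(s : m.-tuple C |
     path (fun a b => a != b) c s && g (last c s)) x c * \prod_(i <- s) x i.
Proof.
elim: m c => [|m IH] c.
  rewrite /= big_mkcond /= (big_pred1 [tuple]) ?big_nil ?mulr1 //.
  by move=> s /=; symmetry; apply/eqP; exact: tuple0.
rewrite [RHS]big_mkcond big_tuple_cons /= mulr_sumr [LHS]big_mkcond /=.
apply: eq_bigr => a _; rewrite IH eq_sym; case: (c != a) => /=; last first.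
  by rewrite big1.
rewrite mulr_sumr [LHS]big_mkcond; apply: eq_bigr => s _.
by case: ifP => // _; rewrite big_cons.
Qed.

Section TwinCycle.
Variables (m : nat) (v : cycle_graph m.+2).

(** The colours of the cycle are listed starting at [v], with vertices subtracted in the cyclic
    group on ['I_m.+2]; this makes the position of [v] irrelevant. The first component colours
    v'. *)
Definition twin_coloring (p : C * m.+2.-tuple C) : {ffun twin v -> C} :=
  [ffun u => if u is Some i then tnth p.2 ((i : 'I_m.+2) - v) else p.1].

Lemma twin_coloring_bij : bijective twin_coloring.
Proof.
exists (fun kappa : {ffun twin v -> C} =>
  (kappa None, [tuple kappa (Some ((v : 'I_m.+2) + i)) | i < m.+2])).
  move=> [b L]; rewrite /twin_coloring ffunE /=; congr (_, _).
  by apply/eq_from_tnth => i; rewrite tnth_mktuple ffunE addrC addKr.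
move=> kappa; apply/ffunP => -[i|]; rewrite ffunE //= tnth_mktuple.
by rewrite addrC subrK.
Qed.

(** The clause [i != j] of [cycle_adj] is automatic, because 1 is nonzero modulo [m + 2]. *)
Lemma cycle_adjE (i j : 'I_m.+2) :
  @cycle_adj m.+2 i j = (j == i + 1) || (i == j + 1).
Proof.
have sE (k l : 'I_m.+2) : (l == k.+1 %% m.+2 :> nat)%N = (l == k + 1).
  by rewrite -val_eqE /= modnDmr addn1.
rewrite /cycle_adj !sE; case: eqVneq => [->|//] /=.
by rewrite orbb -[X in X == _]addr0 (inj_eq (addrI _)).
Qed.

(** Going round the cycle gives the conditions on [a], [c] and [s]. The new vertex is joined to [v]
    and to the vertices one step after and one step before it, coloured [a], [c] and [last c s]. *)
Lemma properb_twin_coloring a b c (s : m.-tuple C) :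
  properb (twin_coloring (b, [tuple of [:: a, c & s]])) =
  [&& b != a, (c != a) && (c != b), path (fun a b => a != b) c s
    & (last c s != a) && (last c s != b)].
Proof.
set L := [tuple of _]; set k := twin_coloring _.
(* [u i] is the vertex [i] steps after [v], so [u m.+2] is [v] again. *)
pose u (i : nat) : twin v := Some ((v : 'I_m.+2) + i%:R).
have kE i : (i < m.+2)%N -> k (u i) = nth a L i.
  move=> im; rewrite /k ffunE -[LHS]/(tnth L ((v : 'I_m.+2) + i%:R - v)).
  by rewrite (addrC (v : 'I_m.+2)) addrK (tnth_nth a) Zp_nat /= modn_small.
have kN : k None = b by rewrite /k ffunE.
have uadj i : adj (u i) (u i.+1).
  by rewrite /= cycle_adjE -addrA -natr1 addrA eqxx.
have cycE : cycle (fun a b => a != b) L =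
    [&& c != a, path (fun a b => a != b) c s & last c s != a].
  by rewrite /= rcons_path eq_sym.
have n0 : m.+2%:R = 0 :> 'I_m.+2 by exact: (@pchar_Zp m.+2).
have uS : u m.+2 = u 0 by rewrite /u n0.
have uex (w : cycle_graph m.+2) : exists2 i, (i < m.+2)%N & Some w = u i.
  exists ((w : 'I_m.+2) - v : 'I_m.+2) => //.
  by rewrite /u natr_Zp addrC subrK.
have uP (w : cycle_graph m.+2) : (w == v) || adj v w ->
    [\/ Some w = u 0, Some w = u 1 | Some w = u m.+1].
  rewrite /= cycle_adjE => /or3P[] /eqP wE.
  - by constructor 1; rewrite wE /u addr0.
  - by constructor 2; rewrite wE.
  - by constructor 3; rewrite /u wE -addrA nat1r n0 addr0.
have k0 : k (u 0) = a by rewrite kE.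
have k1 : k (u 1) = c by rewrite kE.
have kl : k (u m.+1) = last c s.
  by rewrite kE //= (last_nth a) size_tuple.
apply/idP/idP => [/forallP P|/and5P[ba /andP[ca cb] cs la lb]].
  have {}P i j : adj i j -> k i != k j by move/forallP: (P i) => /(_ j)/implyP.
  have cyc : cycle (fun a b => a != b) L.
    apply/cycle_nthP => i; rewrite /= size_tuple => im.
    have := P _ _ (uadj i); rewrite kE //.
    move: im; rewrite ltnS leq_eqVlt => /orP[/eqP->|im].
      by rewrite uS k0 modnn.
    by rewrite kE ?ltnS // modn_small.
  move: cyc; rewrite cycE => /and3P[-> -> ->] /=.
  have bP i : adj (None : twin v) (u i) -> b != k (u i) by move/P; rewrite kN.
  have := bP 0%N; rewrite /= addr0 eqxx k0 => -> //=.
  have := bP 1%N; rewrite /= cycle_adjE eqxx orbT k1 eq_sym => -> //=.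
  rewrite eq_sym; have := bP m.+1; rewrite /= cycle_adjE kl; apply.
  by rewrite -addrA natr1 n0 addr0 eqxx !orbT.
have {ca la}cyc : cycle (fun a b => a != b) L by rewrite cycE ca cs la.
have step i : (i < m.+2)%N -> k (u i) != k (u i.+1).
  move=> im; have := cycle_nthP _ _ _ cyc i; rewrite /= size_tuple => /(_ im).
  rewrite kE //; move: im; rewrite ltnS leq_eqVlt => /orP[/eqP->|im].
    by rewrite uS k0 modnn.
  by rewrite kE ?ltnS // modn_small.
have bP w : (w == v) || adj v w -> b != k (Some w).
  by move/uP => [] ->; rewrite ?k0 ?k1 ?kl // eq_sym.
apply/forallP => i; apply/forallP => j; apply/implyP.
case: i j => [i|] [j|] //; rewrite ?kN; last 2 first.
- by move/bP; rewrite eq_sym.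
- exact: bP.
rewrite /= cycle_adjE => ij.
(* The claim is symmetric in the two ends, so the edge may be taken to go one step forward. *)
wlog {ij} -> : i j / j = (i : 'I_m.+2) + 1.
  by move=> H; case/orP: ij => /eqP ij; [|rewrite eq_sym]; apply: H.
have [l lm iE] := uex i; rewrite iE.
have -> : Some ((i : 'I_m.+2) + 1) = u l.+1 :> twin v.
  by case: iE => ->; rewrite /u -natr1 addrA.
exact: step.
Qed.

Lemma coloring_sum_twin_cycle : coloring_sum (twin v) = twin_sum x m.
Proof.
rewrite /coloring_sum (reindex twin_coloring) /=; last first.
  exact: onW_bij twin_coloring_bij.
rewrite big_mkcond.
transitivity (\sum_b \sum_(L : m.+2.-tuple C)
  if properb (twin_coloring (b, L)) then x b * \prod_(i <- L) x i else 0).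
  rewrite pair_big /=; apply: eq_bigr => -[b L] _.
  case: ifP => // _; rewrite prod_option /= ffunE; congr (_ * _).
  rewrite big_tuple (reindex (fun i : 'I_m.+2 => (v : 'I_m.+2) + i)) /=.
    by apply: eq_bigr => i _; rewrite ffunE addrC addKr.
  by exists (fun i => i - v) => i _; rewrite 1?addrC ?addKr ?subrK.
under eq_bigr do rewrite big_tuple_cons.
(* In [twin_coloring] the colour of v' comes first, in [twin_sum] that of v. *)
rewrite exchange_big /=; apply: eq_bigr => a _.
rewrite [RHS]big_mkcond; apply: eq_bigr => b _; rewrite big_tuple_cons.
rewrite /walks mulr_sumr [X in if _ then X else _]big_mkcond.
case: eqP => [->|/eqP ba] /=.
  rewrite big1 // => c _; rewrite big1 // => s _.
  by rewrite properb_twin_coloring eqxx.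
apply: eq_bigr => c _.
rewrite walkE mulr_sumr [in RHS]big_mkcond /=.
case: ifP => cab; last first.
  by rewrite big1 // => s _; rewrite properb_twin_coloring cab /= andbF.
apply: eq_bigr => s _; rewrite properb_twin_coloring ba cab /=.
by case: ifP => // _; rewrite !big_cons; ring.
Qed.

End TwinCycle.

(** The twin is a single edge, outside the range of [twin_coloring], and its proper colourings are
    the ordered pairs of distinct colours. *)
Lemma coloring_sum_twin1 (v : cycle_graph 1) :
  coloring_sum (twin v) = esym x 2 *+ 2.
Proof.
rewrite -esym2E pair_big_dep /= /coloring_sum.
rewrite (reindex (fun p : C * C =>
  [ffun u : twin v => if u is Some _ then p.1 else p.2])) /=; last first.
  apply: onW_bij; exists (fun k : {ffun twin v -> C} => (k (Some v), k None)).
    by move=> [a b]; rewrite !ffunE.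
  by move=> k; apply/ffunP => -[i|]; rewrite ffunE //= !ord1.
apply: eq_big => [[a b]|[a b] _] /=; last first.
  rewrite prod_option /= ffunE (big_pred1 v) ?ffunE; last first.
    by move=> i; rewrite !ord1.
  by rewrite mulrC.
apply/forallP/idP => [/(_ None)/forallP/(_ (Some v))/implyP|ab].
  by rewrite !ffunE; apply; rewrite /= eqxx.
move=> u; apply/forallP => w; apply/implyP; rewrite !ffunE.
case: u w => [i|] [j|] //=; last by rewrite [a == b]eq_sym.
by rewrite (ord1 i) (ord1 j) cycle_adj_irr.
Qed.

End Colorings.

(** * Restriction to finitely many variables *)

Section Restriction.
Variable N : nat.
Implicit Types (m : {cmonom nat}) (f g : fps).

Definition below m : bool := all (fun i => i < N)%N (finsupp m).

Lemma belowP m : reflect (forall i, (N <= i)%N -> m i = 0%N) (below m).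
Proof.
apply: (iffP allP) => [mN i Ni|mN i]; rewrite /=.
  by apply: contraTeq Ni; rewrite cmE_neq0 -ltnNge; apply: mN.
by rewrite -cmE_neq0; apply: contra_neqT; rewrite -leqNgt; apply: mN.
Qed.

Lemma belowM m1 m2 : below (mmul m1 m2) = below m1 && below m2.
Proof.
apply/belowP/andP => [mN|[/belowP m1N /belowP m2N] i Ni]; last first.
  by rewrite cmM m1N ?m2N.
split; apply/belowP => i /mN /eqP;
  by rewrite cmM addn_eq0 => /andP[/eqP ? /eqP].
Qed.

Lemma below1 : below mone.
Proof. by apply/belowP => i _; rewrite cm1. Qed.

Lemma belowU i : below (ucm i) = (i < N)%N.
Proof.
apply/belowP/idP => [iN|iN j Nj]; last first.
  by rewrite cmU; case: eqP => // ij; move: iN; rewrite ij ltnNge Nj.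
by rewrite ltnNge; apply/negP => /iN; rewrite cmUU.
Qed.

Lemma below_prod (I : Type) (r : seq I) (F : I -> {cmonom nat}) :
  below (\big[mmul/mone]_(i <- r) F i) = all (fun i => below (F i)) r.
Proof.
by elim: r => [|i r IH]; rewrite ?big_nil ?below1 // big_cons belowM IH.
Qed.

(* Setting to zero the variables x_i, i >= N. *)
Definition restr f : fps := FPS (fun m => if below m then f m else 0).

Lemma restr_zmod : GRing.zmod_morphism restr.
Proof.
move=> f g; apply/fpsP => m /=.
by case: (below m) => //=; rewrite oppr0 addr0.
Qed.

(** A product of monomials avoids the variables from [N] on exactly when both factors do. *)
Lemma restr_monoid : GRing.monoid_morphism restr.
Proof.
split=> [|f g]; apply/fpsP => m.
  by rewrite /=; case: eqP => [->|]; rewrite ?below1 // if_same.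
rewrite -[RHS]/(fps_mul (restr f) (restr g) m).
rewrite -[LHS]/(if below m then fps_mul f g m else 0).
rewrite !(coef_fpsMw _ _ (fsubset_refl _)).
case: ifP => bm.
  apply: eq_bigr => a _; apply: eq_bigr => b _.
  case: eqP => [ab|//]; move: bm; rewrite -ab belowM => /andP[ba bb] /=.
  by rewrite ba bb.
rewrite big1 // => a _; rewrite big1 // => b _.
case: eqP => [ab|//]; move: bm; rewrite -ab belowM /=.
by case: (below a); case: (below b); rewrite // ?mul0r ?mulr0.
Qed.

HB.instance Definition _ := GRing.isZmodMorphism.Build fps fps restr restr_zmod.
HB.instance Definition _ :=
  GRing.isMonoidMorphism.Build fps fps restr restr_monoid.

End Restriction.

(** Each monomial involves finitely many variables, so its coefficient survives some restriction. *)
Lemma restr_inj (f g : fps) : (forall N, restr N f = restr N g) -> f = g.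
Proof.
move=> fg; apply/fpsP => m; pose N := (\max_(i <- finsupp m) i).+1.
have bm : below N m.
  by apply/allP => i im; rewrite ltnS; apply: (@leq_bigmax_seq _ _ _ id).
by have /fpsP/(_ m) := fg N; rewrite /= bm.
Qed.

Definition fmonom (m : {cmonom nat}) : fps := FPS (fun m' => (m == m')%:R).

Lemma fmonom1 : fmonom mone = 1.
Proof. by apply/fpsP => m /=; rewrite eq_sym. Qed.

Lemma fmonomM m1 m2 : fmonom (mmul m1 m2) = fmonom m1 * fmonom m2.
Proof.
apply/fpsP => m; rewrite -[RHS]/(fps_mul (fmonom m1) (fmonom m2) m).
(* The index set is enlarged to contain [m1] and [m2] even when they do not divide [m], so that one
   term can be isolated in all cases. *)
have [D [sD m1D m2D]] : exists D,
    [/\ (mdivisors m `<=` D)%fset, m1 \in D & m2 \in D].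
  move: (mdivisors m) => D0; exists (m1 |` (m2 |` D0))%fset.
  split; [|exact: fset1U1|by rewrite fset1Ur // fset1U1].
  by apply/fsubsetP => d dm; rewrite fset1Ur // fset1Ur.
rewrite (coef_fpsMw _ _ sD) (bigD1_seq m1 m1D (fset_uniq D)) /=.
rewrite [X in _ + X]big1 ?addr0; last first.
  move=> a am; rewrite big1 // => b _.
  by rewrite [m1 == a]eq_sym (negbTE am) mul0r mul0rn.
rewrite (bigD1_seq m2 m2D (fset_uniq D)) /= [X in _ + X]big1 ?addr0; last first.
  by move=> b bm; rewrite [m2 == b]eq_sym (negbTE bm) mulr0 mul0rn.
by rewrite !eqxx mulr1.
Qed.

Lemma fmonom_prod (I : Type) (r : seq I) (P : pred I) (F : I -> {cmonom nat}) :
  fmonom (\big[mmul/mone]_(i <- r | P i) F i) =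
  \prod_(i <- r | P i) fmonom (F i).
Proof. exact: (big_morph fmonom fmonomM fmonom1). Qed.

Lemma coef_fps_sum (I : Type) (r : seq I) (P : pred I) (F : I -> fps) m :
  (\sum_(i <- r | P i) F i) m = \sum_(i <- r | P i) F i m.
Proof. by elim/big_rec2: _ => // i u w _ <-. Qed.

(** The hypotheses make [h] a bijection from [U] onto the indices whose monomial is [below N], which
    turns the formal sum into a finite one. *)
Lemma restr_monomial_sum N (T : choiceType) (A : set T)
    (mon : T -> {cmonom nat}) (U : finType) (P : pred U) (h : U -> T) :
  injective h -> (forall u, P u <-> A (h u)) ->
  (forall u, below N (mon (h u))) ->
  (forall t, below N (mon t) -> exists u, h u = t) ->
  restr N (monomial_sum A mon) = \sum_(u | P u) fmonom (mon (h u)).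
Proof.
move=> hI hA hN hS; apply/fpsP => m; rewrite coef_fps_sum /=.
case: ifPn => bm; last first.
  rewrite big1 // => u _; case: eqP => // um.
  by move: bm; rewrite -um hN.
rewrite (fsbigE [seq h u | u <- enum P]).
- rewrite big_map big_enum_cond /=; apply: eq_bigl => u.
  rewrite -topredE /=; apply/andP/idP => [[]|Pu] //.
  by split=> //; apply/asboolP/hA.
- by rewrite map_inj_uniq // enum_uniq.
- by move=> t /= /mapP[u]; rewrite mem_enum => Pu ->; apply/hA.
move=> t At; apply: contraNeq; rewrite pnatr_eq0 eqb0 negbK => /eqP tm.
have [|u ut] := hS t; first by rewrite tm.
by rewrite -ut; apply/map_f; rewrite mem_enum; apply/hA; rewrite ut.
Qed.

Definition var N (i : 'I_N) : fps := fmonom (ucm (i : nat)).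

Lemma restr_chromatic_sym N (G : sgraph) :
  restr N (chromatic_sym G) = coloring_sum (@var N) G.
Proof.
pose h (k : {ffun G -> 'I_N}) : {ffun G -> nat} := [ffun u => val (k u)].
rewrite /chromatic_sym (restr_monomial_sum (P := @properb _ G) (h := h)).
- apply: eq_bigr => k _; rewrite /coloring_monomial fmonom_prod.
  by apply: eq_bigr => u _; rewrite ffunE.
- move=> k k' /ffunP kk; apply/ffunP => u.
  by have := kk u; rewrite !ffunE; apply: val_inj.
- move=> k; split=> [/forallP P u w uw|P].
    move/forallP: (P u) => /(_ w)/implyP/(_ uw); rewrite !ffunE.
    by move=> /eqP nk /val_inj.
  apply/forallP => u; apply/forallP => w; apply/implyP => /P.
  by rewrite !ffunE => nk; apply/eqP => kk; apply: nk; rewrite kk.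
- move=> k; rewrite /coloring_monomial below_prod; apply/allP => u _.
  by rewrite belowU ffunE; apply: ltn_ord.
move=> k; rewrite /coloring_monomial below_prod => /allP kN.
have {}kN u : (k u < N)%N by rewrite -belowU; apply: kN; rewrite mem_index_enum.
by exists [ffun u => Ordinal (kN u)]; apply/ffunP => u; rewrite !ffunE.
Qed.

Lemma restr_elem_sym N k : restr N (elem_sym k) = esym (@var N) k.
Proof.
pose h (S : {set 'I_N}) : {fset nat} := seq_fset tt (map val (enum S)).
have hE S : perm_eq (h S) (map val (enum S)).
  rewrite (perm_trans (seq_fset_perm _ _)) // undup_id //.
  by rewrite map_inj_uniq ?enum_uniq //; apply: val_inj.
have memh S i : (val i \in h S) = (i \in S).
  by rewrite (perm_mem (hE S)) mem_map ?mem_enum //; apply: val_inj.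
rewrite /elem_sym.
rewrite (restr_monomial_sum (P := fun S : {set 'I_N} => #|S| == k) (h := h)).
- apply: eq_bigr => S _; rewrite /subset_monomial (perm_big _ (hE S)) /=.
  by rewrite big_map fmonom_prod big_enum.
- by move=> S S' SS; apply/setP => i; rewrite -!memh SS.
- move=> S /=; rewrite (perm_size (hE S)) size_map -cardE.
  by split=> /eqP.
- move=> S; rewrite /subset_monomial below_prod; apply/allP => i.
  by rewrite (perm_mem (hE S)) => /mapP[j _ ->]; rewrite belowU; apply: ltn_ord.
move=> S; rewrite /subset_monomial below_prod => /allP SN.
exists [set i : 'I_N | val i \in S]; apply/fsetP => i.
rewrite (perm_mem (hE _)); apply/mapP/idP => [[j]|iS].
  by rewrite mem_enum inE => ? ->.
have iN : (i < N)%N by rewrite -belowU; apply: SN.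
by exists (Ordinal iN); rewrite // mem_enum inE.
Qed.

(** By [restr_inj] it suffices to compare restrictions, and there this is [twin_sum_rec] for the
    variables [var N]. *)
Lemma twin_cycle_rec m (v : forall n, cycle_graph n)
    (X := fun n => chromatic_sym (twin (v n))) :
  X m.+2 =
  \sum_(2 <= k < m.+1) (k - 1)%:R * elem_sym k * X (m.+2 - k)%N
  + (2 * m.+3 * (2 * m + 1))%:R * elem_sym m.+3
  + 2%:R * m.+1%:R * (m%:R - 1) * elem_sym 1 * elem_sym m.+2
  - 2%:R * (m%:R - 1) * elem_sym 2 * elem_sym m.+1.
Proof.
apply: restr_inj => N.
rewrite restr_chromatic_sym coloring_sum_twin_cycle twin_sum_rec.
move: (2 * m.+3 * (2 * m + 1))%N => c.
rewrite !(rmorph_nat, rmorph1, rmorphD, rmorphN, rmorphM, rmorph_sum) /=.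
rewrite !restr_elem_sym.
do 3![congr (_ + _)].
rewrite !big_nat; apply: eq_bigr => k /andP[k2 km].
rewrite !rmorphM rmorph_nat /= restr_elem_sym restr_chromatic_sym.
rewrite -(coloring_sum_twin_cycle (@var N) (v (m - k).+2)).
by have -> : (m.+2 - k = (m - k).+2)%N by lia.
Qed.

Lemma twin_cycle1 (v : cycle_graph 1) :
  chromatic_sym (twin v) = 2%:R * elem_sym 2.
Proof.
apply: restr_inj => N; rewrite rmorphM rmorph_nat /= restr_chromatic_sym.
by rewrite restr_elem_sym coloring_sum_twin1 mulr_natl.
Qed.

(** * Positivity *)

(* e-positivity with the nonnegative expansion given as a list of partitions
   with repetitions. *)
Definition e_expansion (f : fps) : Prop :=
  exists2 L : seq (seq nat),
    all is_partition L & f = \sum_(la <- L) elem_sym_part la.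

Lemma e_expansionD f g : e_expansion f -> e_expansion g -> e_expansion (f + g).
Proof.
move=> [L Lp ->] [L' Lp' ->]; exists (L ++ L'); last by rewrite big_cat.
by rewrite all_cat Lp.
Qed.

Lemma e_expansion0 : e_expansion 0.
Proof. by exists [::]; rewrite ?big_nil. Qed.

Lemma e_expansion1 : e_expansion 1.
Proof. by exists [:: [::]]; rewrite // big_seq1 /elem_sym_part big_nil. Qed.

Lemma e_expansion_natM n f : e_expansion f -> e_expansion (n%:R * f).
Proof.
move=> fP; rewrite mulr_natl; elim: n => [|n IH]; first exact: e_expansion0.
by rewrite mulrS; apply: e_expansionD.
Qed.

(** Inserting [k] as a new part into each partition, and sorting, realises multiplication by e_k. *)
Lemma e_expansion_eM k f : (0 < k)%N -> e_expansion f ->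
  e_expansion (elem_sym k * f).
Proof.
move=> k0 [L /allP Lp ->]; exists [seq sort geq (k :: la) | la <- L].
  apply/allP => _ /mapP[la /Lp /andP[_ la1] ->]; apply/andP; split.
    by apply: sort_sorted => i j; apply: leq_total.
  by rewrite all_sort /= k0.
rewrite mulr_sumr big_map; apply: eq_bigr => la _.
by rewrite /elem_sym_part [RHS](perm_big (k :: la)) ?perm_sort //= big_cons.
Qed.

Lemma e_expansion_e k : (0 < k)%N -> e_expansion (elem_sym k).
Proof.
by move=> k0; rewrite -[elem_sym k]mulr1; apply/e_expansion_eM/e_expansion1.
Qed.

Lemma e_expansion_sum (I : eqType) (r : seq I) (F : I -> fps) :
  (forall i, i \in r -> e_expansion (F i)) -> e_expansion (\sum_(i <- r) F i).
Proof.
move=> FP; rewrite big_seq; elim/big_ind: _ => //; first exact: e_expansion0.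
exact: e_expansionD.
Qed.

(** The coefficient of a partition is its number of occurrences in the list. *)
Lemma e_expansion_positive f : e_expansion f -> e_positive f.
Proof.
move=> [L /allP Lp ->].
pose c : {fsfun seq nat -> int with 0} :=
  [fsfun la in seq_fset tt L => (count_mem la L)%:Z].
have cE la : c la = (count_mem la L)%:Z.
  rewrite fsfunE seq_fsetE; case: ifPn => // laL.
  by rewrite (count_memPn laL).
have cL la : (la \in finsupp c) = (la \in L).
  by rewrite mem_finsupp cE -has_pred1 has_count lt0n.
exists c; split.
- by move=> la; rewrite cL; apply: Lp.
- by move=> la; rewrite cE.
rewrite [RHS](perm_big (undup L)) /=; last first.
  apply: uniq_perm; rewrite ?fset_uniq ?undup_uniq // => la.
  by rewrite cL mem_undup.
rewrite -big_undup_iterop_count; apply: eq_bigr => la _.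
by rewrite cE -pmulrn mulr_natl.
Qed.

Section TwinnedCycle.
Variable v : forall n, cycle_graph n.
Let X n := chromatic_sym (twin (v n)).
Let e := elem_sym.

Lemma twin_cycle2 : X 2 = 6%:R * e 3.
Proof. by rewrite /X twin_cycle_rec big_geq //= -/e; ring. Qed.

Lemma twin_cycle3 : X 3 = 24%:R * e 4.
Proof. by rewrite /X twin_cycle_rec big_geq //= -/e; ring. Qed.

Lemma twin_cycle4 :
  X 4 = 50%:R * e 5 + 6%:R * e 4 * e 1 + 4%:R * e 3 * e 2.
Proof.
rewrite {1}/X twin_cycle_rec big_nat1 subn1 !subSS subn0 -/(X 2).
rewrite twin_cycle2 -/e /=.
by ring.
Qed.

(** The summand [k = 2] of [twin_cycle_rec] has coefficient 1 and absorbs the only negative term,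
    forming the bracket. *)
Lemma twin_cycle_rec5 n : (5 <= n)%N ->
  X n = \sum_(3 <= k < n.-1) (k - 1)%:R * e k * X (n - k)%N
        + (2 * (n + 1) * (2 * n - 3))%:R * e (n + 1)%N
        + (2 * (n - 1) * (n - 3))%:R * e n * e 1%N
        + e 2%N * (X (n - 2)%N - (2 * (n - 3))%:R * e (n - 1)%N).
Proof.
case: n => [|[|m]] // m3; rewrite {1}/X twin_cycle_rec big_ltn; last by lia.
rewrite -!/(X _) -/e [m.+2.-1]/=.
have -> : (m.+2 + 1 = m.+3)%N by lia.
have -> : (2 * m.+2 - 3 = 2 * m + 1)%N by lia.
have -> : (m.+2 - 1 = m.+1)%N by lia.
have -> : (m.+2 - 3 = m - 1)%N by lia.
(* Since [m] is at least 3, the truncated [m - 1] agrees with the difference in the ring. *)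
rewrite -[(2 - 1)%N]/1%N !natrM (@natrB _ m 1); last by lia.
by ring.
Qed.

(** The bracket of the recurrence at [n] is the second claim at [n - 2], and the sum needs the first
    claim at [n - k], which is at least 2; hence the joint strong induction. *)
Lemma twin_cycle_expansion n :
  ((2 <= n)%N -> e_expansion (X n)) /\
  ((3 <= n)%N -> e_expansion (X n - (2 * (n - 1))%:R * e (n + 1)%N)).
Proof.
elim/ltn_ind: n => n IH.
suff P3 : (3 <= n)%N -> e_expansion (X n - (2 * (n - 1))%:R * e (n + 1)%N).
  split=> // n2; have [n3|n3] := leqP 3 n.
    rewrite -[X n](subrK ((2 * (n - 1))%:R * e (n + 1)%N)).
    apply: e_expansionD; first exact: P3.
    by apply/e_expansion_natM/e_expansion_e; rewrite addn1.
  have -> : n = 2%N by lia.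
  by rewrite twin_cycle2; apply/e_expansion_natM/e_expansion_e.
move=> n3; have [n5|n5] := leqP 5 n; last first.
  have [->|->] : n = 3%N \/ n = 4%N by lia.
    rewrite twin_cycle3.
    have -> : 24%:R * e 4 - 4%:R * e 4 = 20%:R * e 4 by ring.
    exact/e_expansion_natM/e_expansion_e.
  rewrite twin_cycle4.
  have -> : 50%:R * e 5 + 6%:R * e 4 * e 1 + 4%:R * e 3 * e 2 - 6%:R * e 5
    = 44%:R * e 5 + 6%:R * (e 4 * e 1) + 4%:R * (e 3 * e 2) by ring.
  by do 2?[apply: e_expansionD]; apply: e_expansion_natM;
    do ?[apply: e_expansion_eM]; rewrite //; apply: e_expansion_e.
rewrite twin_cycle_rec5 //.
(* The coefficient of e_(n+1) in the recurrence is large enough to pay for the subtracted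
   [2 * (n - 1)]. *)
have -> : (2 * (n + 1) * (2 * n - 3) =
           2 * (n - 1) + (2 * (n + 1) * (2 * n - 3) - 2 * (n - 1)))%N by nia.
rewrite natrD; set d := (_ - 2 * _)%N; set S := \sum_(_ <= _ < _) _.
set Z := X (n - 2)%N - _.
have -> : S + ((2 * (n - 1))%:R + d%:R) * e (n + 1)%N
    + (2 * (n - 1) * (n - 3))%:R * e n * e 1%N + e 2%N * Z
    - (2 * (n - 1))%:R * e (n + 1)%N =
    S + d%:R * e (n + 1)%N + (2 * (n - 1) * (n - 3))%:R * (e n * e 1%N)
    + e 2%N * Z by ring.
apply: e_expansionD; [apply: e_expansionD; [apply: e_expansionD|]|].
- apply: e_expansion_sum => k; rewrite mem_index_iota -mulrA => /andP[k3 kn].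
  apply/e_expansion_natM/e_expansion_eM; first by lia.
  by apply: (IH (n - k)%N _).1; lia.
- by apply/e_expansion_natM/e_expansion_e; rewrite addn1.
- apply/e_expansion_natM/e_expansion_eM; first by lia.
  exact: e_expansion_e.
apply: e_expansion_eM => //.
have := (IH (n - 2)%N _).2; rewrite /Z.
have -> : (n - 2 - 1 = n - 3)%N by lia.
have -> : (n - 2 + 1 = n - 1)%N by lia.
by apply; lia.
Qed.

Lemma twin_cycle_bracket_expansion n : (5 <= n)%N ->
  e_expansion (X (n - 2)%N - (2 * (n - 3))%:R * e (n - 1)%N).
Proof.
move=> n5; have := (twin_cycle_expansion (n - 2)).2.
have -> : (n - 2 - 1 = n - 3)%N by lia.
have -> : (n - 2 + 1 = n - 1)%N by lia.
by apply; lia.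
Qed.

End TwinnedCycle.

Theorem theorem4p6 (v : forall n : nat, cycle_graph n) :
  let X (n : nat) : fps := chromatic_sym (twin (v n)) in
  let e : nat -> fps := elem_sym in
  [/\ forall n : nat, (1 <= n)%N -> e_positive (X n),
      forall n : nat, (5 <= n)%N ->
        X n = \sum_(3 <= k < n.-1) (k - 1)%:R * e k * X (n - k)%N
              + (2 * (n + 1) * (2 * n - 3))%:R * e (n + 1)%N
              + (2 * (n - 1) * (n - 3))%:R * e n * e 1%N
              + e 2%N * (X (n - 2)%N - (2 * (n - 3))%:R * e (n - 1)%N),
      forall n : nat, (5 <= n)%N ->
        e_positive (X (n - 2)%N - (2 * (n - 3))%:R * e (n - 1)%N)
    & [/\ X 1%N = 2%:R * e 2%N,
          X 2%N = 6%:R * e 3%N,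
          X 3%N = 24%:R * e 4%N
        & X 4%N = 50%:R * e 5%N + 6%:R * e 4%N * e 1%N
                  + 4%:R * e 3%N * e 2%N]].
Proof.
move=> X e; split.
- move=> n n1; apply: e_expansion_positive; have [n2|n2] := leqP 2 n.
    exact: (twin_cycle_expansion v n).1.
  have -> : n = 1%N by lia.
  by rewrite /X twin_cycle1; apply/e_expansion_natM/e_expansion_e.
- exact: twin_cycle_rec5.
- by move=> n n5; apply/e_expansion_positive/twin_cycle_bracket_expansion.
- split; [exact: twin_cycle1 | exact: twin_cycle2 | exact: twin_cycle3 |].
  exact: twin_cycle4.
Qed.
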